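(* Let $K$ be a number field, let $b\in K$, $b\neq 0$, and let $\mathcal{E}_1$ be the elliptic curve over $K$ with Weierstrass equation $y^2=x^3+bx$. Let $K_7=K(\mathcal{E}_1[7])$. Fix $j\in\{1,\dots,6\}$ and a sign $\varepsilon\in\{+,-\}$. Then $$K_7=K(i,\zeta_7,y)=K\left(i,\zeta_7,\sqrt{\left(\omega_j+\varepsilon\tfrac{1}{2}\sqrt{\theta_j}+1\right)b\sqrt{\omega_jb+\varepsilon\tfrac{1}{2}b\sqrt{\theta_j}}}\right),$$ where $y=\sqrt{\left(\omega_j+\varepsilon\tfrac{1}{2}\sqrt{\theta_j}+1\right)b\, x}$ with $x=\sqrt{\omega_jb+\varepsilon\tfrac{1}{2}b\sqrt{\theta_j}}$, so that $(x,y)$ is a point of $\mathcal{E}_1$ of exact order $7$.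
   Context: For a positive integer $m$, $\mathcal{E}[m]$ denotes the $m$-torsion subgroup of $\mathcal{E}(\overline{K})$ and $K(\mathcal{E}[m])$ is the field generated over $K$ by the coordinates of all points of $\mathcal{E}[m]$. Let $i$ be a fixed root of $x^2+1$ and $\zeta_7$ a fixed primitive $7$th root of unity in $\overline{K}$. Define the following elements of $\mathbb{Q}(i,\zeta_7)$ (writing $\zeta=\zeta_7$): $\omega_1=(6i+4)\zeta^5+(6i-2)\zeta^4+(2i-2)\zeta^3+(2i+4)\zeta^2+8i\zeta+4i-3$; $\omega_3=(2i+2)\zeta^5+6\zeta^4+(-4i+6)\zeta^3+(-6i+2)\zeta^2-4i\zeta-2i-1$; $\omega_5=(4i-6)\zeta^5+(-2i-4)\zeta^4+(6i-4)\zeta^3-6\zeta^2+4i\zeta+2i-7$; $\theta_1=\frac17\big((-3520i-1568)\zeta^5+(-4800i+2352)\zeta^4+(-256i+2352)\zeta^3+(-1536i-1568)\zeta^2-5056i\zeta-2528i+3584\big)$; $\theta_3=\frac17\big((-256i-2352)\zeta^5+(1280i-3920)\zeta^4+(3264i-3920)\zeta^3+(4800i-2352)\zeta^2+4544i\zeta+2272i+1232\big)$; $\theta_5=\frac17\big((-3264i+3920)\zeta^5+(1536i+1568)\zeta^4+(-3520i+1568)\zeta^3+(1280i+3920)\zeta^2-1984i\zeta-992i+5152\big)$; and for $s\in\{1,3,5\}$, $\omega_{s+1}$ and $\theta_{s+1}$ are the images of $\omega_s$ and $\theta_s$ under complex conjugation, i.e. under the automorphism of $\mathbb{Q}(i,\zeta_7)$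 sending $i\mapsto -i$, $\zeta_7\mapsto\zeta_7^{-1}$. Square roots denote any fixed choice of square root in $\overline{K}$. (The numbers $\pm\sqrt{\omega_jb\pm\frac12 b\sqrt{\theta_j}}$ are the abscissas of the points of exact order 7 of $\mathcal{E}_1$.) *)

(* Defs.v *)
From HB Require Import structures.
From mathcomp Require Import all_boot all_order all_algebra all_field.

Set Implicit Arguments.
Unset Strict Implicit.
Unset Printing Implicit Defensive.

Import GRing.Theory.
Local Open Scope ring_scope.

Section GeneratedField.
Variables (K F : fieldType) (iota : K -> F).

Definition is_subfield (L : F -> Prop) : Prop :=
  [/\ L 1, (forall u v, L u -> L v -> L (u - v))
    & (forall u v, L u -> L v -> L (u / v))].

(* K(S): the intersection of all subfields of F containing iota(K) and S. *)
Definition adjoin (S : F -> Prop) : F -> Prop :=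
  fun u => forall L : F -> Prop, is_subfield L ->
    (forall k, L (iota k)) -> (forall s, S s -> L s) -> L u.

End GeneratedField.

(* The short Weierstrass curve y^2 = x^3 + a x + c over F. Addition is the     *)
(* chord-tangent law on arbitrary points of the plane with O; it is meaningful *)
(* for points of the curve only, and does not involve the coefficient c.       *)
Section Weierstrass.
Variable F : fieldType.

Inductive ecpoint : Type := ECzero | ECaff of F & F.

Variables a c : F.

Definition on_curve (P : ecpoint) : Prop :=
  match P with
  | ECzero => True
  | ECaff x y => y ^+ 2 = x ^+ 3 + a * x + c
  end.

Definition ec_add (P Q : ecpoint) : ecpoint :=
  match P, Q with
  | ECzero, _ => Q
  | _, ECzero => P
  | ECaff x1 y1, ECaff x2 y2 =>
      if (x1 == x2) && (y1 == - y2) then ECzero else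
      let l := if x1 == x2 then (3 * x1 ^+ 2 + a) / (2 * y1)
               else (y2 - y1) / (x2 - x1) in
      let x3 := l ^+ 2 - x1 - x2 in
      ECaff x3 (l * (x1 - x3) - y1)
  end.

Definition ec_mul (m : nat) (P : ecpoint) : ecpoint :=
  iter m (ec_add P) ECzero.

Definition torsion (m : nat) (P : ecpoint) : Prop :=
  on_curve P /\ ec_mul m P = ECzero.

Definition has_exact_order (m : nat) (P : ecpoint) : Prop :=
  [/\ on_curve P, (0 < m)%N, ec_mul m P = ECzero
    & forall k : nat, (0 < k < m)%N -> ec_mul k P <> ECzero].

Definition torsion_coord (m : nat) (u : F) : Prop :=
  exists x y, torsion m (ECaff x y) /\ (u = x \/ u = y).

End Weierstrass.

Arguments ECzero {F}.

(* K(E[m]), for E : y^2 = x^3 + a x + c with a, c in K and F an algebraic      *)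
(* closure of K via iota.                                                      *)
Definition division_field (K F : fieldType) (iota : K -> F) (a c : K)
    (m : nat) : F -> Prop :=
  adjoin iota (torsion_coord (iota a) (iota c) m).

(* omega_j and theta_j, 1 <= j <= 6, with i a square root of -1 and z a        *)
(* primitive 7th root of unity. Complex conjugation on Q(i, z) is the          *)
(* substitution i |-> -i, z |-> z^-1. Indices outside 1..6 get the dummy 0.    *)
Section Coefficients.
Variable F : fieldType.
Implicit Types i z : F.

Definition omega1 i z : F :=
  (6 * i + 4) * z ^+ 5 + (6 * i - 2) * z ^+ 4 + (2 * i - 2) * z ^+ 3
  + (2 * i + 4) * z ^+ 2 + 8 * i * z + 4 * i - 3.

Definition omega3 i z : F :=
  (2 * i + 2) * z ^+ 5 + 6 * z ^+ 4 + (- 4 * i + 6) * z ^+ 3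
  + (- 6 * i + 2) * z ^+ 2 - 4 * i * z - 2 * i - 1.

Definition omega5 i z : F :=
  (4 * i - 6) * z ^+ 5 + (- 2 * i - 4) * z ^+ 4 + (6 * i - 4) * z ^+ 3
  - 6 * z ^+ 2 + 4 * i * z + 2 * i - 7.

Definition theta1 i z : F :=
  7^-1 * ((- 3520 * i - 1568) * z ^+ 5 + (- 4800 * i + 2352) * z ^+ 4
  + (- 256 * i + 2352) * z ^+ 3 + (- 1536 * i - 1568) * z ^+ 2
  - 5056 * i * z - 2528 * i + 3584).

Definition theta3 i z : F :=
  7^-1 * ((- 256 * i - 2352) * z ^+ 5 + (1280 * i - 3920) * z ^+ 4
  + (3264 * i - 3920) * z ^+ 3 + (4800 * i - 2352) * z ^+ 2
  + 4544 * i * z + 2272 * i + 1232).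

Definition theta5 i z : F :=
  7^-1 * ((- 3264 * i + 3920) * z ^+ 5 + (1536 * i + 1568) * z ^+ 4
  + (- 3520 * i + 1568) * z ^+ 3 + (1280 * i + 3920) * z ^+ 2
  - 1984 * i * z - 992 * i + 5152).

Definition omega i z (j : nat) : F :=
  match j with
  | 1 => omega1 i z
  | 2 => omega1 (- i) z^-1
  | 3 => omega3 i z
  | 4 => omega3 (- i) z^-1
  | 5 => omega5 i z
  | 6 => omega5 (- i) z^-1
  | _ => 0
  end.

Definition theta i z (j : nat) : F :=
  match j with
  | 1 => theta1 i z
  | 2 => theta1 (- i) z^-1
  | 3 => theta3 i z
  | 4 => theta3 (- i) z^-1
  | 5 => theta5 i z
  | 6 => theta5 (- i) z^-1
  | _ => 0
  end.

End Coefficients.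

(* Main.v *)
Require Import Defs.
From HB Require Import structures.
From mathcomp Require Import all_boot all_order all_algebra all_field.
From mathcomp Require Import ring.

Set Implicit Arguments.
Unset Strict Implicit.
Unset Printing Implicit Defensive.

Import GRing.Theory.
Local Open Scope ring_scope.

(** Put t = x^2 / b, so that a point of y^2 = x^3 + b x is given by x^2 = t b
and y^2 = (t + 1) b x. The relation 4 P = - 3 P, equivalent to 7 P = O, becomes
psi7(t) = 0 for a polynomial of degree 12. Over Q(i, z) it splits into the six
quadratics with roots omega +- sqrt(theta) / 2 and their conjugates under
z |-> z^k. Complex multiplication by Z[i] permutes the 12 roots by rational
functions of t over Q(i): 1 + i, of norm 2, sends the quadratic of z to that of
z^2, and 2 + i, of norm 5, sends it to that of z^5. Hence a subfield containing
b, i and one point of order 7 contains all of them. It then contains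
2 omega(z^k), the sum of two conjugate roots, for all k, and z is a combination
of these over Q(i). Conversely t(t + 1)^2 = y^4 / b^3 is an affine function of t
modulo the quadratic, so t and x = y^2 / ((t + 1) b) lie in K(i, z, y). *)

(** * The group law *)

Definition ec_opp (F : fieldType) (P : ecpoint F) : ecpoint F :=
  if P is ECaff x y then ECaff x (- y) else ECzero.

Lemma ec_oppK (F : fieldType) : involutive (@ec_opp F).
Proof. by case=> //= x y; rewrite opprK. Qed.

Lemma ec_addP0 (F : fieldType) (a : F) (P : ecpoint F) : ec_add a P ECzero = P.
Proof. by case: P. Qed.

Section GroupLaw.
Variables (F : fieldType) (a c : F).
Hypothesis two_neq0 : 2 != 0 :> F.
Hypothesis disc_neq0 : 4 * a ^+ 3 + 27 * c ^+ 2 != 0.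

(* The line of slope l through (x1, y1) meets the curve at x1, x2 and          *)
(* l ^+ 2 - x1 - x2; the tangent case is x1 = x2, y1 = y2.                     *)
Definition on_line (l x1 y1 x2 y2 : F) : Prop :=
  y2 = y1 + l * (x2 - x1) /\
  x1 ^+ 2 + x1 * x2 + x2 ^+ 2 + a = l * (y1 + y2).

(** The second clause of [on_line] is the difference of the two curve equations divided by
    [x2 - x1]; at equal points it becomes the tangent slope formula. *)
Lemma on_line_exists x1 y1 x2 y2 :
  on_curve a c (ECaff x1 y1) -> on_curve a c (ECaff x2 y2) ->
  ~~ ((x1 == x2) && (y1 == - y2)) -> exists l, on_line l x1 y1 x2 y2.
Proof.
move=> /= h1 h2; have [x12|x12 _] := eqVneq x1 x2.
  rewrite -{}x12 /= in h2 * => y12.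
  have y12' : y2 = y1.
    have /eqP : y1 ^+ 2 = y2 ^+ 2 by rewrite h1 h2.
    by rewrite eqf_sqr (negbTE y12) orbF => /eqP.
  rewrite {}y12' in y12 h2 *.
  have y1n : 2 * y1 != 0.
    by move: y12; rewrite -subr_eq0 opprK (_ : y1 + y1 = 2 * y1) //; ring.
  exists ((3 * x1 ^+ 2 + a) / (2 * y1)); split; first by ring.
  by rewrite (_ : y1 + y1 = 2 * y1) ?divfK //; ring.
have xn : x2 - x1 != 0 by rewrite subr_eq0 eq_sym.
exists ((y2 - y1) / (x2 - x1)); split; first by rewrite divfK // addrC subrK.
apply: (mulfI xn).
have -> : (x2 - x1) * ((y2 - y1) / (x2 - x1) * (y1 + y2)) = y2 ^+ 2 - y1 ^+ 2.
  by field.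
by rewrite h1 h2; ring.
Qed.

Lemma ec_add_on_line l x1 y1 x2 y2 : on_line l x1 y1 x2 y2 ->
  ~~ ((x1 == x2) && (y1 == - y2)) ->
  ec_add a (ECaff x1 y1) (ECaff x2 y2) =
  ECaff (l ^+ 2 - x1 - x2) (l * (x1 - (l ^+ 2 - x1 - x2)) - y1).
Proof.
move=> [hy hl] /[dup] hn /negbTE /= ->.
have [x12|x12] := eqVneq x1 x2.
  have hy' : y2 = y1 by rewrite hy x12 subrr mulr0 addr0.
  have y1n : 2 * y1 != 0.
    move: hn; rewrite x12 eqxx hy' /= -subr_eq0 opprK.
    by rewrite (_ : y1 + y1 = 2 * y1) //; ring.
  suff -> : (3 * x1 ^+ 2 + a) / (2 * y1) = l by [].
  apply: (mulIf y1n); rewrite divfK //.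
  move: hl; rewrite hy' -x12 => hl.
  have -> : l * (2 * y1) = l * (y1 + y1) by ring.
  by rewrite -hl; ring.
suff -> : (y2 - y1) / (x2 - x1) = l by [].
by rewrite hy addrC addKr mulfK // subr_eq0 eq_sym.
Qed.

(** With the ordinate taken on the line, the second clause of [on_line] is a monic quadratic in the
    second abscissa, with sum of roots [l ^+ 2 - x1]; [x2] and the third abscissa are its two
    roots. *)
Lemma on_line_third l x1 y1 x2 y2 : on_line l x1 y1 x2 y2 ->
  on_line l x1 y1 (l ^+ 2 - x1 - x2) (y1 + l * (l ^+ 2 - x1 - x2 - x1)).
Proof.
move=> [hy hl]; split=> //; apply/eqP; rewrite -subr_eq0; apply/eqP.
move/eqP: hl; rewrite -subr_eq0 hy => /eqP <-; ring.
Qed.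

Lemma on_curve_third l x1 y1 x2 y2 : on_curve a c (ECaff x1 y1) ->
  on_line l x1 y1 x2 y2 -> on_curve a c (ECaff x2 y2).
Proof.
move=> /= h1 [hy hl]; apply/eqP; rewrite -subr_eq0; apply/eqP.
have -> : y2 ^+ 2 - (x2 ^+ 3 + a * x2 + c) =
  (y1 ^+ 2 - (x1 ^+ 3 + a * x1 + c)) - (x2 - x1) *
  (x1 ^+ 2 + x1 * x2 + x2 ^+ 2 + a - l * (y1 + y2)) by rewrite hy; ring.
by rewrite h1 hl !subrr mulr0 subr0.
Qed.

Lemma on_curve_opp P : on_curve a c P -> on_curve a c (ec_opp P).
Proof. by case: P => //= x y; rewrite sqrrN. Qed.

Lemma on_curve_add P Q :
  on_curve a c P -> on_curve a c Q -> on_curve a c (ec_add a P Q).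
Proof.
case: P => [|x1 y1] //; case: Q => [|x2 y2] // hP hQ.
have [h|h] := boolP ((x1 == x2) && (y1 == - y2)); first by rewrite /= h.
have [l hl] := on_line_exists hP hQ h.
rewrite (ec_add_on_line hl h).
have /on_curve_opp := on_curve_third hP (on_line_third hl).
rewrite [ec_opp _]/=; congr (on_curve a c (ECaff _ _)); ring.
Qed.

Lemma on_curve_mul n P : on_curve a c P -> on_curve a c (ec_mul a n P).
Proof. by move=> hP; elim: n => //= n IH; apply: on_curve_add. Qed.

(** Otherwise [x] would be a double root of the cubic, whose discriminant would vanish. *)
Lemma curve_smooth x : on_curve a c (ECaff x 0) -> 3 * x ^+ 2 + a != 0.
Proof.
move=> /= h; apply: contraNneq disc_neq0 => h'.
have -> : a = - (3 * x ^+ 2) by apply/eqP; rewrite -addr_eq0 addrC h'.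
have -> : c = - (x ^+ 3 + a * x).
  by apply/eqP; rewrite -addr_eq0 addrC -h expr0n.
have -> : a = - (3 * x ^+ 2) by apply/eqP; rewrite -addr_eq0 addrC h'.
by apply/eqP; ring.
Qed.

(** Takes the place of associativity below. P, Q and - (P + Q) lie on one line, so the slope for P
    and Q also serves for P and - (P + Q). If the latter two were opposite, then [y1 = 0] and the
    tangent condition would make P singular. *)
Lemma ec_addKN P Q : on_curve a c P -> on_curve a c Q ->
  ec_add a P (ec_opp (ec_add a P Q)) = ec_opp Q.
Proof.
case: P => [|x1 y1] //; case: Q => [|x2 y2] // hP hQ.
  by rewrite /= opprK !eqxx.
have [h|h] := boolP ((x1 == x2) && (y1 == - y2)).
  by rewrite /= h /=; move/andP: h => [/eqP -> /eqP ->].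
have [l hl] := on_line_exists hP hQ h.
rewrite (ec_add_on_line hl h) [ec_opp _]/=.
set x3 := l ^+ 2 - x1 - x2.
have -> : - (l * (x1 - x3) - y1) = y1 + l * (x3 - x1) by ring.
have hl3 := on_line_third hl; rewrite -/x3 in hl3.
rewrite (ec_add_on_line hl3); last first.
  apply/andP=> -[/eqP x13]; rewrite -x13 subrr mulr0 addr0 -subr_eq0 opprK.
  rewrite (_ : y1 + y1 = 2 * y1); last by ring.
  rewrite mulf_eq0 (negbTE two_neq0) /= => /eqP y10.
  rewrite y10 in hP; have /negP := curve_smooth hP; apply.
  case: hl3 => _; rewrite -x13 y10 subrr mulr0 !addr0 mulr0 => <-.
  by apply/eqP; ring.
case: hl => -> _; rewrite /x3 /=; congr ECaff; ring.
Qed.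

(** [ec_addKN] carries one copy of P across at a time: 7 P = O gives - 6 P = P, then - 5 P = 2 P,
    then - 4 P = 3 P; the converse climbs back. *)
Lemma ec_mul7_eq0 P : on_curve a c P ->
  ec_mul a 7 P = ECzero <-> ec_mul a 4 P = ec_opp (ec_mul a 3 P).
Proof.
move=> hP; have hm n := on_curve_mul n hP.
have mS n : ec_mul a n.+1 P = ec_add a P (ec_mul a n P) by [].
have m1 : ec_mul a 1 P = P by rewrite mS ec_addP0.
split=> [h7|h4].
  have h6 : ec_opp (ec_mul a 6 P) = P.
    by rewrite -(ec_addKN hP (hm 6)) -mS h7 ec_addP0.
  have h5 : ec_opp (ec_mul a 5 P) = ec_mul a 2 P.
    by rewrite -(ec_addKN hP (hm 5)) -mS h6 [ec_mul a 2 P]mS m1.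
  rewrite -[LHS]ec_oppK; congr ec_opp.
  by rewrite -(ec_addKN hP (hm 4)) -mS h5.
have h5 : ec_mul a 5 P = ec_opp (ec_mul a 2 P).
  by rewrite mS h4 mS (ec_addKN hP (hm 2)).
have h6 : ec_mul a 6 P = ec_opp P.
  by rewrite mS h5 mS (ec_addKN hP (hm 1%N)) m1.
rewrite mS h6; case: {h4 h5 h6 m1 mS hP hm} P => //= x y.
by rewrite opprK !eqxx.
Qed.

End GroupLaw.

(** * The 7-division polynomial *)

(* The division polynomials of y ^+ 2 = x ^+ 3 + b * x in the variable         *)
(* t = x ^+ 2 / b: psi_3, psi_4 / (4 * y) and psi_5, psi_7, up to powers of b. *)
Section DivisionPolynomials.
Variable R : comNzRingType.
Implicit Types t : R.

Definition psi3 t := 3 * t ^+ 2 + 6 * t - 1.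
Definition psi4 t := (t - 1) * (t ^+ 2 + 6 * t + 1).
Definition psi5 t := 32 * t * (t + 1) ^+ 2 * psi4 t - psi3 t ^+ 3.
Definition psi7 t :=
  psi5 t * psi3 t ^+ 3 - 128 * t * (t + 1) ^+ 2 * psi4 t ^+ 3.

End DivisionPolynomials.

Section SevenTorsion.
Variables (F : fieldType) (b : F).
Hypothesis two_neq0 : 2 != 0 :> F.
Hypothesis b_neq0 : b != 0.

Lemma disc_b_neq0 : 4 * b ^+ 3 + 27 * 0 ^+ 2 != 0.
Proof.
rewrite expr0n mulr0 addr0 mulf_neq0 ?expf_neq0 //.
by rewrite (_ : 4 = 2 * 2) ?mulf_neq0 //; ring.
Qed.

(** By Bezout: [psi3] is 8 modulo t - 1, and a multiple of it is 32 modulo t^2 + 6 t + 1. *)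
Lemma psi3_psi4_coprime (t : F) : psi3 t = 0 -> psi4 t = 0 -> False.
Proof.
have n8 : 8 != 0 :> F.
  by rewrite (_ : 8 = 2 * 2 * 2) ?mulf_neq0 //; ring.
move=> h3 /eqP; rewrite mulf_eq0 => /orP[] /eqP h4; move/eqP: n8; apply.
  transitivity (psi3 t - (t - 1) * (3 * t + 9)); first by rewrite /psi3; ring.
  by rewrite h3 h4; ring.
have n4 : 4 != 0 :> F by rewrite (_ : 4 = 2 * 2) ?mulf_neq0 //; ring.
apply: (mulfI n4); rewrite mulr0.
transitivity ((3 * t + 17) * (3 * (t ^+ 2 + 6 * t + 1) - psi3 t)
   - 36 * (t ^+ 2 + 6 * t + 1)); first by rewrite /psi3; ring.
by rewrite h3 h4; ring.
Qed.

Variables x y t : F.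
Hypothesis hx : x ^+ 2 = t * b.
Hypothesis hy : y ^+ 2 = (t + 1) * b * x.
Let P := ECaff x y.

Lemma on_curve_scaled : on_curve b 0 P.
Proof.
by rewrite /= hy addr0 exprSr hx; ring.
Qed.

Lemma ec_mul7_neq0 : y = 0 -> ec_mul b 7 P <> ECzero.
Proof.
move=> y0 /(ec_mul7_eq0 two_neq0 disc_b_neq0 on_curve_scaled).
by rewrite /ec_mul /P y0 /= oppr0 !eqxx /= oppr0 !eqxx.
Qed.

Hypothesis y_neq0 : y != 0.

Lemma x_neq0 : x != 0.
Proof. by apply: contraNneq y_neq0 => x0; rewrite -sqrf_eq0 hy x0 mulr0. Qed.

Lemma t_neq0 : t != 0.
Proof. by apply: contraNneq x_neq0 => t0; rewrite -sqrf_eq0 hx t0 mul0r. Qed.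

Lemma t1_neq0 : t + 1 != 0.
Proof. by apply: contraNneq y_neq0 => t0; rewrite -sqrf_eq0 hy t0 !mul0r. Qed.

Let xn := x_neq0.
Let tn := t_neq0.
Let t1n := t1_neq0.

Lemma y2_div_x2 : y ^+ 2 / x ^+ 2 = x * ((t + 1) / t).
Proof.
by rewrite hy hx; field; rewrite b_neq0 tn.
Qed.

(** Multiples of P are written in units of [x] and [y]. Slopes are then [y / x] times a function of
    [t], and [y2_div_x2] turns their squares into multiples of [x], so the computation takes place
    in rational functions of [t]. *)
Lemma ec_add_scaled r s : r != 1 ->
  let m := (s - 1) / (r - 1) in
  let r' := m ^+ 2 * ((t + 1) / t) - 1 - r in
  ec_add b P (ECaff (x * r) (y * s)) = ECaff (x * r') (y * (m * (1 - r') - 1)).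
Proof.
move=> r1 m r' /=.
have -> : (x == x * r) = false.
  by rewrite -{1}[x]mulr1 (inj_eq (mulfI xn)) eq_sym (negbTE r1).
have -> : (y * s - y) / (x * r - x) = y / x * m.
  rewrite /m (_ : x * r - x = x * (r - 1)); last by ring.
  by field; rewrite xn subr_eq0 r1.
have -> : (y / x * m) ^+ 2 - x - x * r = x * r'.
  have -> : (y / x * m) ^+ 2 = y ^+ 2 / x ^+ 2 * m ^+ 2 by field.
  by rewrite y2_div_x2 /r'; ring.
by congr ECaff; field.
Qed.

Lemma four_neq0 : 4 != 0 :> F.
Proof. by rewrite (_ : 4 = 2 * 2) ?mulf_neq0 //; ring. Qed.

Lemma eight_neq0 : 8 != 0 :> F.
Proof. by rewrite (_ : 8 = 4 * 2) ?mulf_neq0 ?four_neq0 //; ring. Qed.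

Let n4 := four_neq0.
Let n8 := eight_neq0.

Lemma sixteen_neq0 : 16 != 0 :> F.
Proof. by rewrite (_ : 16 = 8 * 2) ?mulf_neq0 ?eight_neq0 //; ring. Qed.

Let n16 := sixteen_neq0.

Lemma ec_double_scaled : ec_add b P P =
  ECaff (x * ((t - 1) ^+ 2 / (4 * t * (t + 1))))
        (y * (psi4 t / (8 * t * (t + 1) ^+ 2))).
Proof.
rewrite /= eqxx /= -subr_eq0 opprK (_ : y + y = 2 * y); last by ring.
rewrite mulf_eq0 (negbTE two_neq0) (negbTE y_neq0) /=.
set m := (3 * t + 1) / (2 * (t + 1)).
have -> : (3 * x ^+ 2 + b) / (2 * y) = y / x * m.
  apply: (mulIf (mulf_neq0 two_neq0 y_neq0)); rewrite divfK ?mulf_neq0 //.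
  have -> : y / x * m * (2 * y) = y ^+ 2 * (2 * m / x) by ring.
  by rewrite hy hx /m; field; rewrite xn t1n two_neq0.
have -> : (y / x * m) ^+ 2 - x - x = x * ((t - 1) ^+ 2 / (4 * t * (t + 1))).
  have -> : (y / x * m) ^+ 2 = y ^+ 2 / x ^+ 2 * m ^+ 2 by field.
  rewrite y2_div_x2 /m.
  by field; rewrite two_neq0 t1n tn n4.
congr ECaff; rewrite /m /psi4.
by field; rewrite tn n4 t1n two_neq0 xn n8.
Qed.

Definition mul3_slope := (7 * t ^+ 3 + 11 * t ^+ 2 + 13 * t + 1)
  / (2 * (t + 1) * psi3 t).
Definition mul3_x := ((t ^+ 2 - 6 * t - 3) / psi3 t) ^+ 2.
Definition mul3_y := mul3_slope * (1 - mul3_x) - 1.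

Lemma mul2E : ec_mul b 2 P = ECaff (x * ((t - 1) ^+ 2 / (4 * t * (t + 1))))
        (y * (psi4 t / (8 * t * (t + 1) ^+ 2))).
Proof. exact: ec_double_scaled. Qed.

Lemma mul3E : psi3 t != 0 -> ec_mul b 3 P = ECaff (x * mul3_x) (y * mul3_y).
Proof.
move=> p3; rewrite [LHS](_ : _ = ec_add b P (ec_mul b 2 P)) // mul2E.
have E : (t - 1) ^+ 2 / (4 * t * (t + 1)) - 1 = - psi3 t / (4 * t * (t + 1)).
  by rewrite /psi3; field; rewrite tn t1n n4.
rewrite ec_add_scaled; last first.
  by rewrite -subr_eq0 E mulf_neq0 ?oppr_eq0 ?invr_neq0 ?mulf_neq0.
rewrite E.
have -> : (psi4 t / (8 * t * (t + 1) ^+ 2) - 1) / (- psi3 t / (4 * t * (t + 1)))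
   = mul3_slope.
  rewrite /mul3_slope /psi4; field.
  by rewrite oppr_eq0 p3 tn t1n n4 n8 two_neq0.
have -> : mul3_slope ^+ 2 * ((t + 1) / t) - 1 - (t - 1) ^+ 2 / (4 * t * (t + 1))
   = mul3_x.
  rewrite /mul3_slope /mul3_x; move: p3; rewrite /psi3 => p3.
  by field; rewrite p3 tn t1n n4 two_neq0.
by [].
Qed.

Lemma mul3_x_sub1 : psi3 t != 0 ->
  mul3_x - 1 = - 8 * (t + 1) * psi4 t / psi3 t ^+ 2.
Proof. by rewrite /mul3_x /psi4 /psi3 => p3; field. Qed.

(** Comparing abscissas is enough: - 4 P lies on the chord through P and 3 P, so if its abscissa is
    that of 3 P, it is 3 P itself. *)
Lemma mul4_opp_mul3 : psi3 t != 0 -> psi4 t != 0 ->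
  ec_mul b 4 P = ec_opp (ec_mul b 3 P) <-> psi7 t = 0.
Proof.
move=> p3 p4; have -> : ec_mul b 4 P = ec_add b P (ec_mul b 3 P) by [].
have d1 : mul3_x - 1 != 0.
  rewrite mul3_x_sub1 // mulf_neq0 ?invr_neq0 ?expf_neq0 //.
  by rewrite mulf_neq0 // mulf_neq0 // oppr_eq0.
rewrite (mul3E p3) ec_add_scaled -?[_ == 1]subr_eq0 // [ec_opp _]/=.
set m := (mul3_y - 1) / (mul3_x - 1).
have Em : m =
  (psi3 t ^+ 3 - 2 * (7 * t ^+ 3 + 11 * t ^+ 2 + 13 * t + 1) * psi4 t)
  / (4 * (t + 1) * psi3 t * psi4 t).
  have -> : m = - mul3_slope - 2 / (mul3_x - 1).
    by rewrite /m /mul3_y; field.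
  rewrite mul3_x_sub1 // /mul3_slope.
  by field; rewrite p3 p4 t1n n4 two_neq0 ?oppr_eq0 ?n8.
have E : m ^+ 2 * ((t + 1) / t) - 1 - mul3_x - mul3_x =
   - psi7 t / (16 * t * (t + 1) * psi3 t ^+ 2 * psi4 t ^+ 2).
  rewrite Em /mul3_x; move: p3 p4.
  rewrite /psi7 /psi5 /psi4 /psi3 => p3 /[dup] p4.
  rewrite mulf_eq0 negb_or => /andP[p4l p4r].
  by field; rewrite p4l p4r p3 t1n tn n4 n16.
split=> [[/(mulfI xn) h _]|h].
  move: E; rewrite h subrr => /esym /eqP.
  rewrite mulf_eq0 oppr_eq0 invr_eq0 => /orP[/eqP //|].
  apply: contraTeq => _; do 2![apply: mulf_neq0; last exact: expf_neq0].
  by rewrite !mulf_neq0 ?n16.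
move/eqP: E; rewrite h oppr0 mul0r subr_eq0 => /eqP ->.
by congr ECaff; rewrite /m; field.
Qed.

(** The chord formulas break down when [psi3 t = 0], where 2 P = P or - P, and when [psi4 t = 0],
    where 3 P = - P. In both cases 7 P is not O, and [psi7 t] is nonzero by coprimality of [psi3]
    and [psi4]. *)
Lemma ec_mul7_psi7 : ec_mul b 7 P = ECzero <-> psi7 t = 0.
Proof.
apply: (iff_trans (ec_mul7_eq0 two_neq0 disc_b_neq0 on_curve_scaled)).
have [p3|p3] := eqVneq (psi3 t) 0.
  split=> [h|]; last first.
    rewrite /psi7 p3 expr0n mulr0 sub0r => /eqP; rewrite oppr_eq0 mulf_eq0.
    have /negbTE -> : 128 * t * (t + 1) ^+ 2 != 0.
      rewrite (_ : 128 = 16 * 8); last by ring.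
      by rewrite !mulf_neq0 ?expf_neq0.
    by rewrite expf_eq0 => /eqP /(psi3_psi4_coprime p3).
  exfalso.
  have m2 : ec_mul b 2 P = P \/ ec_mul b 2 P = ec_opp P.
    have := on_curve_mul 2 on_curve_scaled; rewrite mul2E.
    have -> : (t - 1) ^+ 2 / (4 * t * (t + 1)) = 1.
      apply/eqP; rewrite -subr_eq0 -oppr_eq0; apply/eqP.
      transitivity (psi3 t / (4 * t * (t + 1))); last by rewrite p3 mul0r.
      by rewrite /psi3; field; rewrite tn t1n n4.
    rewrite mulr1; set s := _ / _; have /= <- := on_curve_scaled.
    by move=> /eqP; rewrite eqf_sqr => /orP[] /eqP ->; [left|right].
  have mS n : ec_mul b n.+1 P = ec_add b P (ec_mul b n P) by [].
  have m1 : ec_mul b 1 P = P by [].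
  case: m2 => m2.
    have m3 : ec_mul b 3 P = P by rewrite mS m2 -{2}m1 -mS m2.
    move: h; rewrite mS m3 -{2}m1 -mS m2 => -[] /eqP.
    rewrite -subr_eq0 opprK (_ : y + y = 2 * y); last by ring.
    by rewrite mulf_eq0 (negbTE two_neq0) (negbTE y_neq0).
  have m3 : ec_mul b 3 P = ECzero by rewrite mS m2 /= opprK !eqxx.
  by move: h; rewrite mS m3.
have [p4|p4] := eqVneq (psi4 t) 0; last exact: mul4_opp_mul3.
split=> [|/eqP]; last first.
  rewrite /psi7 /psi5 p4 mulr0 sub0r expr0n mulr0 subr0 mulNr oppr_eq0.
  by rewrite mulf_eq0 expf_eq0 (negbTE p3).
have r1 : mul3_x = 1.
  by apply/eqP; rewrite -subr_eq0 mul3_x_sub1 // p4 mulr0 mul0r.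
have m3 : ec_mul b 3 P = ec_opp P.
  by rewrite mul3E // /mul3_y r1 subrr mulr0 sub0r mulr1 mulrN1.
rewrite [ec_mul b 4 P](_ : _ = ec_add b P (ec_mul b 3 P)) // m3 /=.
by rewrite opprK !eqxx.
Qed.

End SevenTorsion.

(** * The quadratic factors of the 7-division polynomial over Q(i, z) *)

Section QuadraticFactors.
Variable F : fieldType.
Implicit Types i z t : F.

Definition qa i z : F :=
  3 * i * z ^+ 5 + (5 * i + 5) * z ^+ 4 + (3 * i + 5) * z ^+ 3
  + 5 * i * z ^+ 2 + 8 * i * z + 4 * i + 2.

Definition qc i z : F :=
  (- i + 6) * z ^+ 5 + (3 * i + 11) * z ^+ 4 + (9 * i + 11) * z ^+ 3
  + (13 * i + 6) * z ^+ 2 + 12 * i * z + 6 * i - 3.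

(* A scalar multiple of (t - omega1) ^+ 2 - theta1 / 4. In this normalization  *)
(* the endomorphism 1 + i, which acts by t |-> - (t + 1) ^+ 2 / (4 * t), acts  *)
(* on the roots by t |-> qa i z * t + qc i z.                                  *)
Definition quad i z t := (t + 1) ^+ 2 + 4 * t * (qa i z * t + qc i z).

Lemma quad_root_neq0 i z t : quad i z t = 0 -> t != 0.
Proof.
move=> h; apply: contra_eq_neq h => ->.
by rewrite /quad mulr0 mul0r addr0 add0r expr1n oner_neq0.
Qed.

(** The 7th cyclotomic relation, with a monomial on the left so that [ring: hz] can reduce by it. *)
Lemma prim_root7_eq z : 7.-primitive_root z ->
  z ^+ 6 = - (z ^+ 5 + z ^+ 4 + z ^+ 3 + z ^+ 2 + z + 1).
Proof.
move=> hz; have z1 : z - 1 != 0.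
  rewrite subr_eq0; apply: contraL (dvdnn 7) => /eqP z1.
  have := prim_order_dvd hz 1; rewrite z1 expr1n eqxx => /esym.
  by rewrite dvdn1.
apply/eqP; rewrite -addr_eq0 -(inj_eq (mulfI z1)) mulr0; apply/eqP.
by transitivity (z ^+ 7 - 1); [ring | rewrite (prim_expr_order hz) subrr].
Qed.

Hypothesis natS_neq0 : forall n : nat, n.+1%:R != 0 :> F.
Variables i z : F.
Hypotheses (hi : i ^+ 2 = - 1) (pz : 7.-primitive_root z).

Let hz := prim_root7_eq pz.

(** The factor after [i] is the quadratic Gauss sum modulo 7, of square - 7. *)
Definition sqrt7 := i * (1 + 2 * (z + z ^+ 2 + z ^+ 4)).

Lemma sqr_sqrt7 : sqrt7 ^+ 2 = 7.
Proof. rewrite /sqrt7; ring: hi hz. Qed.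

(** The exponents 1, 2, 4 are the squares modulo 7, so the product is invariant under z |-> z^2 and
    its coefficients lie in Q(i, sqrt(-7)), which contains [sqrt7]. *)
Lemma quad_prod3 t :
  quad i z t * quad i (z ^+ 2) t * quad i (z ^+ 4) t =
  21 * t ^+ 6 + 14 * t ^+ 5 + 119 * t ^+ 4 + 308 * t ^+ 3 + 147 * t ^+ 2
  - 98 * t + 1 + sqrt7 *
  (8 * t * (t ^+ 5 + t ^+ 4 + 2 * t ^+ 3 - 6 * t ^+ 2 - 3 * t + 5)).
Proof. rewrite /quad /qa /qc /sqrt7; ring: hi hz. Qed.

Lemma quad_omega1 t :
  28 * quad i z t =
  (1 + 4 * qa i z) * (28 * (t - omega1 i z) ^+ 2 - 7 * theta1 i z).
Proof.
rewrite /theta1 (mulVKf (natS_neq0 6)) /quad /omega1 /qa /qc.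
ring: hi hz.
Qed.

Lemma quad_lead_unit : (1 + 4 * qa i z) *
  (12 * i * z ^+ 5 + (52 * i - 28) * z ^+ 4 + (- 20 * i - 28) * z ^+ 3
   + 20 * i * z ^+ 2 + 32 * i * z + 16 * i - 49) = 7.
Proof. rewrite /qa; ring: hi hz. Qed.

Lemma omega3_omega1 : omega3 i z = omega1 i (z ^+ 5).
Proof. rewrite /omega1 /omega3; ring: hz. Qed.

Lemma omega5_omega1 : omega5 i z = omega1 i (z ^+ 3).
Proof. rewrite /omega1 /omega5; ring: hz. Qed.

Lemma theta3_theta1 : theta3 i z = theta1 i (z ^+ 5).
Proof. rewrite /theta1 /theta3; congr (_ * _); ring: hz. Qed.

Lemma theta5_theta1 : theta5 i z = theta1 i (z ^+ 3).
Proof. rewrite /theta1 /theta5; congr (_ * _); ring: hz. Qed.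

(** Complex conjugation fixes [omega1], so [omega] takes the same value at an even index as at the
    preceding odd one. *)
Lemma omega1_conj : omega1 (- i) (z ^+ 6) = omega1 i z.
Proof. rewrite /omega1; ring: hz. Qed.

Lemma theta1_conj : theta1 (- i) (z ^+ 6) = theta1 i z.
Proof. rewrite /theta1; congr (_ * _); ring: hz. Qed.

Lemma quad_sub t t' : quad i z t - quad i z t' =
  (1 + 4 * qa i z) * ((t - t') * (t + t' - 2 * omega1 i z)).
Proof. rewrite /quad /omega1 /qa /qc; ring: hi hz. Qed.

(** The left side is quadratic in [t] and shares the roots of [quad i z], so the cofactor is
    constant in [t]. *)
Lemma quad_affine t :
  quad i (z ^+ 2) (qa i z * t + qc i z) =
  ((10 * i + 12) * z ^+ 5 + (- 4 * i + 5) * z ^+ 4 + (12 * i + 5) * z ^+ 3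
   + (- 2 * i + 12) * z ^+ 2 + 8 * i * z + 4 * i + 16) * quad i z t.
Proof. rewrite /quad /qa /qc; ring: hi hz. Qed.

(* (1 + i) ^+ 3 has norm 8 = 1 mod 7, so it fixes z and swaps the two roots.   *)
Lemma affine3_conj t :
  qa i (z ^+ 4) * (qa i (z ^+ 2) * (qa i z * t + qc i z) + qc i (z ^+ 2))
    + qc i (z ^+ 4) = 2 * omega1 i z - t.
Proof. rewrite /omega1 /qa /qc; ring: hi hz. Qed.

(** The six conjugates of [omega1] span Q(i, z) over Q(i). These are the coordinates of [z], with
    1232 = 2^4 * 7 * 11 clearing denominators. *)
Lemma z_from_omega1 : 1232 * z =
  (2 - 55 * i) * omega1 i z - (20 + 33 * i) * omega1 i (z ^+ 2)
  + (46 - 11 * i) * omega1 i (z ^+ 3) + (46 + 11 * i) * omega1 i (z ^+ 4)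
  - (20 - 33 * i) * omega1 i (z ^+ 5) + (2 + 55 * i) * omega1 i (z ^+ 6).
Proof. rewrite /omega1; ring: hi hz. Qed.

Lemma quad_lead_neq0 : 1 + 4 * qa i z != 0.
Proof.
by apply: contra_eq_neq quad_lead_unit => ->; rewrite mul0r eq_sym natS_neq0.
Qed.

Lemma quad_rootP t t' : quad i z t = 0 -> quad i z t' = 0 ->
  t' = t \/ t' = 2 * omega1 i z - t.
Proof.
move=> h h'; have /esym/eqP := quad_sub t t'; rewrite h h' subrr.
rewrite mulf_eq0 (negbTE quad_lead_neq0) mulf_eq0 !subr_eq0 /=.
by case/orP=> /eqP E; [left | right; rewrite -E addrC addKr].
Qed.

Lemma quad_root_omega1 s : s ^+ 2 = theta1 i z ->
  quad i z (omega1 i z + 2^-1 * s) = 0.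
Proof.
move=> hs; apply: (mulfI (natS_neq0 27)); rewrite mulr0 quad_omega1 -hs.
have n2 := natS_neq0 1; by field.
Qed.

(* The endomorphism 2 + i, of degree 5, multiplies x by mul_2i t ^+ 2, hence   *)
(* t by mul_2i t ^+ 4.                                                         *)
Definition mul_2i t := (t + 1 - 2 * i) / ((2 + i) * t + i).

(** Modulo [quad i z], the denominator of [mul_2i] divides four times its numerator, so both would
    vanish; but these two linear forms have no common root. *)
Lemma mul_2i_denom_neq0 t : quad i z t = 0 -> (2 + i) * t + i != 0.
Proof.
move=> h; apply/eqP => d0.
have : 4 * (t + 1 - 2 * i) = 0.
  transitivity (((2 + i) * t + i) *
    (((5 * i + 5) * z ^+ 5 + 10 * z ^+ 4 + (- 5 * i + 5) * z ^+ 3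
      + (2 * i + 4) * z - 2 * i + 4) * t
     + ((- i + 3) * z ^+ 5 + (- 4 * i + 2) * z ^+ 4 + (- 3 * i - 1) * z ^+ 3
      + (- 2 * i - 4) * z - 2 * i - 4))
    - ((3 * i + 1) * z ^+ 5 + (2 * i + 4) * z ^+ 4 + (- i + 3) * z ^+ 3
      + (- 4 * i + 2) * z + 4 * i - 2) * quad i z t).
    rewrite /quad /qa /qc; ring: hi hz.
  by rewrite h d0 mul0r mulr0 subr0.
move=> h4; have /eqP := natS_neq0 31; apply.
transitivity ((4 * ((2 + i) * t + i) - (2 + i) * (4 * (t + 1 - 2 * i)))
  * (- 1 - i)).
  ring: hi.
by rewrite d0 h4 !mulr0 subr0 mul0r.
Qed.

Lemma quad_mul_2i t : quad i z t = 0 ->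
  quad i (z ^+ 5) (t * mul_2i t ^+ 4) = 0.
Proof.
move=> h; have dn := mul_2i_denom_neq0 h.
(* The remainders modulo [quad i z], linear in [t], of 4 [mul_2i i t], u^2 / 8, t v and v w / 4 are
   [u], [v], [w] and [f] in turn; hence [f] is the new parameter. *)
pose u := ((5 * i + 5) * z ^+ 5 + 10 * z ^+ 4 + (- 5 * i + 5) * z ^+ 3
  + (2 * i + 4) * z - 2 * i + 4) * t
  + ((- i + 3) * z ^+ 5 + (- 4 * i + 2) * z ^+ 4 + (- 3 * i - 1) * z ^+ 3
  + (- 2 * i - 4) * z - 2 * i - 4).
pose v := (- 11 * i * z ^+ 5 + (- 6 * i - 11) * z ^+ 4 + (5 * i - 1) * z ^+ 3
  + (- 7 * i + 11) * z ^+ 2 + (- 18 * i - 2) * z - 5 * i - 11) * t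
  + ((i - 2) * z ^+ 5 + (4 * i + 1) * z ^+ 4 + (- i + 5) * z ^+ 3
  + (- 5 * i + 5) * z ^+ 2 + (- 2 * i + 2) * z + i + 1).
pose w := ((- i - 2) * z ^+ 5 - z ^+ 4 + (- 3 * i - 1) * z ^+ 3
  + (- 3 * i - 5) * z ^+ 2 + (2 * i - 6) * z + 3 * i - 1) * t
  + (- i * z ^+ 5 + (- 2 * i - 1) * z ^+ 4 + (- i - 3) * z ^+ 3
  + (- i - 3) * z ^+ 2 + (2 * i - 2) * z + i - 1).
pose f := ((3 * i - 14) * z ^+ 5 + (23 * i - 11) * z ^+ 4
  + (23 * i + 11) * z ^+ 3 + (3 * i + 14) * z ^+ 2 + 6 * i) * t
  + (7 * i * z ^+ 5 + (9 * i + 7) * z ^+ 4 + (5 * i + 13) * z ^+ 3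
  + (- i + 12) * z ^+ 2 + (- 4 * i + 8) * z - 4 * i + 3).
have Eu : ((2 + i) * t + i) * u = 4 * (t + 1 - 2 * i).
  apply/eqP; rewrite -subr_eq0; apply/eqP.
  transitivity (((3 * i + 1) * z ^+ 5 + (2 * i + 4) * z ^+ 4
    + (- i + 3) * z ^+ 3 + (- 4 * i + 2) * z + 4 * i - 2) * quad i z t).
    rewrite /quad /qa /qc /u; ring: hi hz.
  by rewrite h mulr0.
have Ev : u ^+ 2 = 8 * v.
  apply/eqP; rewrite -subr_eq0; apply/eqP.
  transitivity (((10 * i - 8) * z ^+ 5 + (18 * i - 8) * z ^+ 4
    + 28 * i * z ^+ 3 + (26 * i + 12) * z ^+ 2 + (14 * i + 20) * z
    + 2 * i + 12) * quad i z t).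
    rewrite /quad /qa /qc /u /v; ring: hi hz.
  by rewrite h mulr0.
have Ew : t * v = w.
  apply/eqP; rewrite -subr_eq0; apply/eqP.
  transitivity ((i * z ^+ 5 + (2 * i + 1) * z ^+ 4 + (i + 3) * z ^+ 3
    + (i + 3) * z ^+ 2 + (- 2 * i + 2) * z - i + 1) * quad i z t).
    rewrite /quad /qa /qc /v /w; ring: hi hz.
  by rewrite h mulr0.
have Ef : v * w = 4 * f.
  apply/eqP; rewrite -subr_eq0; apply/eqP.
  transitivity (((- 4 * i - 20) * z ^+ 5 + (12 * i - 38) * z ^+ 4
    + (36 * i - 35) * z ^+ 3 + (48 * i - 12) * z ^+ 2 + (36 * i + 7) * z
    + 16 * i + 12) * quad i z t).
    rewrite /quad /qa /qc /v /w /f; ring: hi hz.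
  by rewrite h mulr0.
have n4 := natS_neq0 3.
have -> : mul_2i t = u / 4.
  have -> : u = 4 * (t + 1 - 2 * i) / ((2 + i) * t + i).
    by rewrite -Eu mulrAC mulfV // mul1r.
  by rewrite /mul_2i; field; rewrite dn n4.
have -> : t * (u / 4) ^+ 4 = f.
  transitivity (t * (u ^+ 2) ^+ 2 / 4 ^+ 4).
    by field; rewrite ?expf_neq0 ?natS_neq0.
  rewrite Ev; transitivity (v * (t * v) / 4).
    by field; rewrite ?expf_neq0 ?natS_neq0.
  by rewrite Ew Ef mulrAC mulfV // mul1r.
transitivity (((- 34 * i + 28) * z ^+ 5 + (20 * i - 3) * z ^+ 4
  + (- 20 * i - 3) * z ^+ 3 + (34 * i + 28) * z ^+ 2 + 56) * quad i z t).
  rewrite /quad /qa /qc /f; ring: hi hz.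
by rewrite h mulr0.
Qed.

(* On the curve, t * (t + 1) ^+ 2 = y ^+ 4 / b ^+ 3.                           *)
Lemma t_from_y4 t : quad i z t = 0 ->
  9492 * t =
  ((549 * i + 52) * z ^+ 5 + (181 * i + 786) * z ^+ 4
   + (- 403 * i + 786) * z ^+ 3 + (- 771 * i + 52) * z ^+ 2 - 222 * i * z
   - 111 * i - 73) *
  (7 * (t * (t + 1) ^+ 2)
   - 4 * ((471 * i + 266) * z ^+ 5 + (487 * i - 217) * z ^+ 4
          + (125 * i - 217) * z ^+ 3 + (141 * i + 266) * z ^+ 2 + 612 * i * z
          + 306 * i - 273)).
Proof.
move=> h; apply/eqP; rewrite -subr_eq0; apply/eqP.
(* Modulo [quad i z], 7 t (t + 1)^2 is affine in [t]. Its constant term is what the second factor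
   subtracts, and the first factor is 9492 over its slope. *)
transitivity (- ((549 * i + 52) * z ^+ 5 + (181 * i + 786) * z ^+ 4
   + (- 403 * i + 786) * z ^+ 3 + (- 771 * i + 52) * z ^+ 2 - 222 * i * z
   - 111 * i - 73) *
  ((12 * i * z ^+ 5 + (52 * i - 28) * z ^+ 4 + (- 20 * i - 28) * z ^+ 3
   + 20 * i * z ^+ 2 + 32 * i * z + 16 * i - 49) * t
   - 4 * ((471 * i + 266) * z ^+ 5 + (487 * i - 217) * z ^+ 4
          + (125 * i - 217) * z ^+ 3 + (141 * i + 266) * z ^+ 2 + 612 * i * z
          + 306 * i - 273)) * quad i z t).
  rewrite /quad /qa /qc; ring: hi hz.
by rewrite h mulr0.
Qed.

End QuadraticFactors.

Lemma prim_root7X (F : fieldType) (z : F) k :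
  7.-primitive_root z -> ~~ (7 %| k)%N -> 7.-primitive_root (z ^+ k).
Proof.
by move=> pz hk; rewrite prim_root_exp_coprime // coprime_sym prime_coprime.
Qed.

(** Since 3 is not a square modulo 7, z |-> z^3 exchanges the two triples and negates [sqrt7]. The
    whole product is thus a norm A^2 - 7 B^2. *)
Lemma quad_prod (F : fieldType) (i z t : F) :
  i ^+ 2 = - 1 -> 7.-primitive_root z ->
  quad i z t * quad i (z ^+ 2) t * quad i (z ^+ 4) t
  * (quad i (z ^+ 3) t * quad i (z ^+ 6) t * quad i (z ^+ 5) t) = - psi7 t.
Proof.
move=> hi pz; rewrite (quad_prod3 hi pz).
have := quad_prod3 hi (prim_root7X pz (k := 3) isT) t.
have -> : sqrt7 i (z ^+ 3) = - sqrt7 i z.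
  have hz := prim_root7_eq pz; rewrite /sqrt7; ring: hz.
rewrite -!exprM -[z ^+ (3 * 4)](prim_expr_mod pz) => ->.
have h7 := sqr_sqrt7 hi pz; move: h7; set v := sqrt7 i z => h7.
rewrite /psi7 /psi5 /psi4 /psi3; ring: h7.
Qed.

(** * Points with coordinates in a subfield *)

Section Subfield.
Variables (F : fieldType) (L : F -> Prop).
Hypothesis hL : is_subfield L.

Lemma subfield1 : L 1. Proof. by case: hL. Qed.

Lemma subfield0 : L 0.
Proof. by case: hL => L1 LB _; rewrite -(subrr 1); apply: LB. Qed.

Lemma subfieldN u : L u -> L (- u).
Proof.
by case: hL => _ LB _ Lu; rewrite -sub0r; apply: LB => //; apply: subfield0.
Qed.

Lemma subfieldD u v : L u -> L v -> L (u + v).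
Proof.
case: hL => _ LB _ Lu Lv; rewrite -[v]opprK.
by apply: LB => //; apply: subfieldN.
Qed.

Lemma subfieldV u : L u -> L u^-1.
Proof. by case: hL => L1 _ LV Lu; rewrite -div1r; apply: LV. Qed.

Lemma subfieldM u v : L u -> L v -> L (u * v).
Proof.
case: hL => _ _ LV Lu Lv; rewrite -[v]invrK.
by apply: LV => //; apply: subfieldV.
Qed.

Lemma subfieldX u n : L u -> L (u ^+ n).
Proof.
move=> Lu; elim: n => [|n IH]; first exact: subfield1.
by rewrite exprS; apply: subfieldM.
Qed.

Lemma subfield_nat n : L n%:R.
Proof.
elim: n => [|n IH]; first exact: subfield0.
by rewrite mulrS; apply: subfieldD => //; apply: subfield1.
Qed.

End Subfield.

Ltac in_subfield hL := repeat first
  [ assumption | exact: (subfield1 hL) | exact: (subfield0 hL)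
  | exact: (subfield_nat hL) | apply: (subfieldD hL) | apply: (subfieldN hL)
  | apply: (subfieldX hL) | apply: (subfieldV hL) | apply: (subfieldM hL) ].

Section SubfieldPoints.
Variables (F : fieldType) (b i : F).
Hypothesis natS_neq0 : forall n : nat, n.+1%:R != 0 :> F.
Hypotheses (b_neq0 : b != 0) (hi : i ^+ 2 = - 1).
Variable L : F -> Prop.
Hypotheses (hL : is_subfield L) (Lb : L b) (Li : L i).

(** Only [t] is recorded: the points (x, y) and (x, - y), (- x, i y) and (- x, - i y) above it
    differ by units of Z[i], so with [i] in [L] they are all defined over [L] together. *)
Definition has_point (t : F) : Prop :=
  exists x y, [/\ L x, L y, x ^+ 2 = t * b & y ^+ 2 = (t + 1) * b * x].

Lemma has_point_in t : has_point t -> L t.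
Proof.
case=> x [y [Lx _ hx _]]; have -> : t = x ^+ 2 / b by rewrite hx mulfK.
in_subfield hL.
Qed.

Lemma has_point_1i z t : quad i z t = 0 -> has_point t ->
  has_point (qa i z * t + qc i z).
Proof.
move=> hq ht; have Lt := has_point_in ht; case: ht => x [y [Lx Ly hx hy]].
have tn := quad_root_neq0 hq.
have n2 := natS_neq0 1; have n4 := natS_neq0 3.
have -> : qa i z * t + qc i z = - (t + 1) ^+ 2 / (4 * t).
  apply: (mulfI (mulf_neq0 n4 tn)).
  rewrite [RHS]mulrC divfK ?mulf_neq0 //; apply/eqP.
  by rewrite -subr_eq0 opprK addrC; apply/eqP.
(* The sum of (x, y) and its image (- x, i y) under multiplication by [i]. *)
exists (- i * x * (t + 1) / (2 * t)), (- y * (1 + i) * (t - 1) / (4 * t)).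
split; [by in_subfield hL | by in_subfield hL | |].
  transitivity (i ^+ 2 * x ^+ 2 * ((t + 1) / (2 * t)) ^+ 2).
    by field; rewrite n2 tn.
  by rewrite hi hx; field; rewrite n2 n4 tn.
transitivity ((1 + 2 * i + i ^+ 2) * y ^+ 2 * ((t - 1) / (4 * t)) ^+ 2).
  by field; rewrite n4 tn.
by rewrite hi hy; field; rewrite n2 n4 tn.
Qed.

Lemma has_point_2i t : (2 + i) * t + i != 0 -> has_point t ->
  has_point (t * mul_2i i t ^+ 4).
Proof.
move=> dn ht; have Lt := has_point_in ht; case: ht => x [y [Lx Ly hx hy]].
have LC : L (mul_2i i t) by rewrite /mul_2i; in_subfield hL.
have n5 := natS_neq0 4.
have n2i : 2 + i != 0.
  apply: contra_neq n5 => h2; transitivity ((2 + i) * (2 - i)).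
    by rewrite mulrC -subr_sqr hi; ring.
  by rewrite h2 mul0r.
pose d := (2 + i) * t + i.
exists (x * mul_2i i t ^+ 2).
(* Multiplication by 2 + i scales dx / y by 2 + i, so the new ordinate is y (dX/dx) / (2 + i) with X
   = x [mul_2i i t]^2; the factor (- 4 + 4 i) / d^2 is the derivative of [mul_2i i] in [t]. *)
exists (y * (mul_2i i t ^+ 2 + 4 * t * mul_2i i t * (- 4 + 4 * i) / d ^+ 2)
        / (2 + i)).
split; [by in_subfield hL | by rewrite /d; in_subfield hL | |].
  by rewrite exprMn hx; ring.
rewrite !exprMn hy /d /mul_2i.
field: hi; by rewrite n2i dn.
Qed.

Section Roots.
Variable z : F.
Hypothesis pz : 7.-primitive_root z.

Lemma prim_root7_mod k : z ^+ k = z ^+ (k %% 7).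
Proof. by rewrite (prim_expr_mod pz). Qed.

Lemma quad_1i t : quad i z t = 0 -> quad i (z ^+ 2) (qa i z * t + qc i z) = 0.
Proof. by move=> h; rewrite quad_affine // h mulr0. Qed.

End Roots.

Lemma has_point_conj z t : 7.-primitive_root z -> quad i z t = 0 ->
  has_point t -> has_point (2 * omega1 i z - t).
Proof.
move=> pz h ht; rewrite -affine3_conj //.
have h2 := quad_1i pz h; have h4 := quad_1i (prim_root7X pz (k := 2) isT) h2.
rewrite -exprM in h4.
by do 3![apply: has_point_1i => //].
Qed.

Lemma has_point_roots z t t' : 7.-primitive_root z ->
  quad i z t = 0 -> has_point t -> quad i z t' = 0 -> has_point t'.
Proof.
move=> pz h ht h'; case: (quad_rootP natS_neq0 hi pz h h') => -> //.
exact: has_point_conj.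
Qed.

Lemma omega1_in z t : 7.-primitive_root z -> quad i z t = 0 ->
  has_point t -> L (omega1 i z).
Proof.
move=> pz h ht.
have -> : omega1 i z = (2 * omega1 i z - t + t) / 2.
  by rewrite subrK mulrAC mulfV ?mul1r ?(natS_neq0 1).
have Lt := has_point_in ht; have Lt' := has_point_in (has_point_conj pz h ht).
by in_subfield hL.
Qed.

(** 2 and 5 generate the units modulo 7: 2 and 4 come from 1 + i alone, 5 from 2 + i, and then 3 = 2
    * 5 and 6 = 2 * 3 modulo 7. *)
Lemma root_point_powers z t : 7.-primitive_root z -> quad i z t = 0 ->
  has_point t -> forall k, ~~ (7 %| k)%N ->
  exists t', quad i (z ^+ k) t' = 0 /\ has_point t'.
Proof.
have step2 w u : 7.-primitive_root w -> quad i w u = 0 -> has_point u ->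
    exists t', quad i (w ^+ 2) t' = 0 /\ has_point t'.
  move=> pw h hu; exists (qa i w * u + qc i w).
  by split; [apply: quad_1i | apply: has_point_1i].
have step5 w u : 7.-primitive_root w -> quad i w u = 0 -> has_point u ->
    exists t', quad i (w ^+ 5) t' = 0 /\ has_point t'.
  move=> pw h hu; exists (u * mul_2i i u ^+ 4); split.
    exact: quad_mul_2i.
  by apply: has_point_2i => //; apply: (mul_2i_denom_neq0 natS_neq0 hi pw).
move=> pz h ht k; rewrite /dvdn (prim_root7_mod pz).
have [t2 [h2 p2]] := step2 _ _ pz h ht.
have [t4 [h4 p4]] := step2 _ _ (prim_root7X pz (k := 2) isT) h2 p2.
have [t5 [h5 p5]] := step5 _ _ pz h ht.
have pz5 := prim_root7X pz (k := 5) isT.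
have [t3 [h3 p3]] := step2 _ _ pz5 h5 p5.
have [t6 [h6 p6]] := step2 _ _ (prim_root7X pz5 (k := 2) isT) h3 p3.
rewrite -!exprM in h4 h3 h6.
rewrite (prim_root7_mod pz) in h3; rewrite (prim_root7_mod pz) in h6.
have := ltn_pmod k (isT : 0 < 7)%N.
move: (k %% 7)%N => [|[|[|[|[|[|[|//]]]]]]] // _ _.
- by exists t.
- by exists t2.
- by exists t3.
- by exists t4.
- by exists t5.
- by exists t6.
Qed.

Lemma zeta7_in z t : 7.-primitive_root z -> quad i z t = 0 ->
  has_point t -> L z.
Proof.
move=> pz h ht.
have Lo k : ~~ (7 %| k)%N -> L (omega1 i (z ^+ k)).
  move=> hk; have [t' [h' ht']] := root_point_powers pz h ht hk.
  exact: (omega1_in (prim_root7X pz hk) h' ht').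
have n := natS_neq0 1231.
have -> : z = 1232 * z / 1232 by rewrite mulrAC mulfV // mul1r.
rewrite (z_from_omega1 hi pz).
have L1 := Lo 1%N isT; have L2 := Lo 2 isT; have L3 := Lo 3 isT.
have L4 := Lo 4 isT; have L5 := Lo 5 isT; have L6 := Lo 6 isT.
rewrite expr1 in L1.
by in_subfield hL.
Qed.

Lemma psi7_quad z t : 7.-primitive_root z ->
  psi7 t = 0 <-> exists k, ~~ (7 %| k)%N /\ quad i (z ^+ k) t = 0.
Proof.
move=> pz; split=> [h|[k [hk h]]].
  have ex k : ~~ (7 %| k)%N -> quad i (z ^+ k) t == 0 ->
    exists k, ~~ (7 %| k)%N /\ quad i (z ^+ k) t = 0.
    by move=> hk /eqP; exists k.
  have /eqP := quad_prod t hi pz; rewrite h oppr0 !mulf_eq0.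
  case/orP=> [/orP[/orP[]|]|/orP[/orP[]|]].
  - exact: (ex 1%N).
  - exact: (ex 2).
  - exact: (ex 4).
  - exact: (ex 3).
  - exact: (ex 6).
  - exact: (ex 5).
apply/eqP; rewrite -oppr_eq0 -(quad_prod t hi (prim_root7X pz hk)) h.
by rewrite !mul0r.
Qed.

(** Some point over [L] has the same parameter [t'], and the given point differs from it by a unit
    of Z[i]. *)
Lemma torsion7_in z t x y : 7.-primitive_root z -> quad i z t = 0 ->
  has_point t -> torsion b 0 7 (ECaff x y) -> L x /\ L y.
Proof.
move=> pz h ht [/= hP h7]; pose t' := x ^+ 2 / b.
have hx : x ^+ 2 = t' * b by rewrite divfK.
have hy : y ^+ 2 = (t' + 1) * b * x.
  by rewrite hP mulrDl -hx; ring.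
have n2 := natS_neq0 1.
have yn : y != 0.
  by apply/eqP => y0; apply: (ec_mul7_neq0 n2 b_neq0 hx hy y0).
have := (ec_mul7_psi7 n2 b_neq0 hx hy yn).1 h7.
case/(psi7_quad _ pz) => k [hk hq].
have [u [hu pu]] := root_point_powers pz h ht hk.
have [X [Y [LX LY hX hY]]] := has_point_roots (prim_root7X pz hk) hu pu hq.
have /eqP : x ^+ 2 = X ^+ 2 by rewrite hx hX.
rewrite eqf_sqr => /orP[] /eqP xX.
  have Ly : L y.
    have /eqP : y ^+ 2 = Y ^+ 2 by rewrite hy hY xX.
    by rewrite eqf_sqr => /orP[] /eqP ->; in_subfield hL.
  by rewrite xX.
have Ly : L y.
  have /eqP : y ^+ 2 = (i * Y) ^+ 2 by rewrite exprMn hi hy hY xX; ring.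
  by rewrite eqf_sqr => /orP[] /eqP ->; in_subfield hL.
by rewrite xX; split => //; in_subfield hL.
Qed.

End SubfieldPoints.

(** * The 7-division field and its generators *)

Section DivisionField.
Variables (F : fieldType) (b i z t x y : F).
Hypothesis natS_neq0 : forall n : nat, n.+1%:R != 0 :> F.
Hypotheses (b_neq0 : b != 0) (hi : i ^+ 2 = - 1) (pz : 7.-primitive_root z).
Hypotheses (hx : x ^+ 2 = t * b) (hy : y ^+ 2 = (t + 1) * b * x).
Hypothesis hq : quad i z t = 0.

Lemma root_psi7 : psi7 t = 0.
Proof. by apply/(psi7_quad hi t pz); exists 1%N; rewrite expr1. Qed.

Lemma root_y_neq0 : y != 0.
Proof.
rewrite -sqrf_eq0 hy !mulf_neq0 //; last first.
  by rewrite -sqrf_eq0 hx mulf_neq0 // (quad_root_neq0 hq).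
apply: contra_eq_neq root_psi7 => /eqP; rewrite addr_eq0 => /eqP ->.
have -> : psi7 (- 1) = - 4096 :> F by rewrite /psi7 /psi5 /psi4 /psi3; ring.
by rewrite oppr_eq0 natS_neq0.
Qed.

(** Vanishing of 2 P or 3 P contradicts 4 P = - 3 P, and 4 P = O gives 3 P = O. Vanishing of 5 P or
    6 P would make 7 P equal to 2 P or P. *)
Lemma root_exact_order : has_exact_order b 0 7 (ECaff x y).
Proof.
have n2 := natS_neq0 1; have hP := on_curve_scaled hx hy.
have yn := root_y_neq0.
have h7 := (ec_mul7_psi7 n2 b_neq0 hx hy yn).2 root_psi7.
have h4 := (ec_mul7_eq0 n2 (disc_b_neq0 n2 b_neq0) hP).1 h7.
have mS n : ec_mul b n.+1 (ECaff x y)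
  = ec_add b (ECaff x y) (ec_mul b n (ECaff x y)) by [].
have m3 : ec_mul b 3 (ECaff x y) <> ECzero.
  by move=> m0; move: h4; rewrite mS m0.
have m2 : ec_mul b 2 (ECaff x y) <> ECzero.
  move=> m0; have e3 : ec_mul b 3 (ECaff x y) = ECaff x y by rewrite mS m0.
  have e4 : ec_mul b 4 (ECaff x y) = ec_mul b 2 (ECaff x y) by rewrite mS e3.
  by move: h4; rewrite e4 m0 e3.
split=> //; case=> [|[|[|[|[|[|[|k]]]]]]] // _ m0.
- by apply: m3; rewrite -[LHS]ec_oppK -h4 m0.
- apply: m2; rewrite -h7 [RHS]mS.
  by have -> : ec_mul b 6 (ECaff x y) = ECaff x y by rewrite mS m0.
- by move: h7; rewrite mS m0.
Qed.

Variable L : F -> Prop.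
Hypotheses (hL : is_subfield L) (Lb : L b).

Lemma torsion7_sub_generated u : L i -> L z -> L y ->
  torsion_coord b 0 7 u -> L u.
Proof.
move=> Li Lz Ly.
have E := t_from_y4 hi pz hq.
have Lw : L (t * (t + 1) ^+ 2).
  have -> : t * (t + 1) ^+ 2 = (y ^+ 2) ^+ 2 / b ^+ 3.
    by rewrite hy !exprMn hx; field.
  by in_subfield hL.
have Lt : L t.
  have n := natS_neq0 9491.
  have -> : t = 9492 * t / 9492 by rewrite mulrAC mulfV // mul1r.
  by rewrite E; in_subfield hL.
have Lx : L x.
  have t1 : (t + 1) * b != 0.
    by apply: contraNneq root_y_neq0 => t1; rewrite -sqrf_eq0 hy t1 mul0r.
  have -> : x = y ^+ 2 / ((t + 1) * b) by rewrite hy mulrAC mulfV // mul1r.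
  by in_subfield hL.
have hp : has_point b L t by exists x, y.
case=> x' [y' [hT hu]].
have [Lx' Ly'] := torsion7_in natS_neq0 b_neq0 hi hL Lb Li pz hq hp hT.
by case: hu => ->.
Qed.

(** The point (- x, i y) is also 7-torsion, so [i] is a quotient of two torsion ordinates; [z] then
    comes from [zeta7_in]. *)
Lemma generators_in_torsion7 : (forall u, torsion_coord b 0 7 u -> L u) ->
  [/\ L i, L z & L y].
Proof.
move=> LT; have n2 := natS_neq0 1; have yn := root_y_neq0.
have h7 x' y' : x' ^+ 2 = t * b -> y' ^+ 2 = (t + 1) * b * x' -> y' != 0 ->
    L x' /\ L y'.
  move=> hx' hy' yn'.
  have T : torsion b 0 7 (ECaff x' y').
    split; first exact: (on_curve_scaled hx' hy').
    exact: (ec_mul7_psi7 n2 b_neq0 hx' hy' yn').2 root_psi7.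
  by split; apply: LT; exists x', y'; split=> //; [left | right].
have [Lx Ly] := h7 _ _ hx hy yn.
have [|||Lx' Liy] := h7 (- x) (i * y).
- by rewrite sqrrN.
- by rewrite exprMn hi hy; ring.
- rewrite mulf_neq0 //; apply: contra_eq_neq hi => ->.
  by rewrite expr0n eq_sym oppr_eq0 oner_neq0.
have Li : L i.
  by have -> : i = i * y / y; [rewrite mulfK | in_subfield hL].
split=> //; apply: (zeta7_in natS_neq0 b_neq0 hi hL Lb Li pz hq).
by exists x, y.
Qed.

End DivisionField.

Theorem theorem1 (K : fieldExtType rat) (Kbar : closedFieldType)
    (iota : {rmorphism K -> Kbar})
    (Kbar_alg : forall u : Kbar, algebraicOver iota u)
    (i z : Kbar) (hi : i ^+ 2 + 1 = 0) (hz : 7.-primitive_root z)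
    (b : K) (hb : b != 0)
    (j : nat) (hj : (1 <= j <= 6)%N) (e : bool)
    (s x y : Kbar)
    (hs : s ^+ 2 = theta i z j)
    (hx : x ^+ 2 = omega i z j * iota b + (-1) ^+ e * (2^-1 * iota b * s))
    (hy : y ^+ 2 = (omega i z j + (-1) ^+ e * (2^-1 * s) + 1) * iota b * x) :
  (forall u : Kbar,
     division_field iota b 0 7 u <-> adjoin iota (fun v => v \in [:: i; z; y]) u)
  /\ has_exact_order (iota b) (iota 0) 7 (ECaff x y).
Proof.
have natS_neq0 (n : nat) : n.+1%:R != 0 :> Kbar.
  rewrite -(rmorph_nat iota) fmorph_eq0 -(rmorph_nat (in_alg K)) fmorph_eq0.
  by rewrite Num.Theory.pnatr_eq0.
have {}hi : i ^+ 2 = - 1 by apply/eqP; rewrite -addr_eq0 hi.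
have b0 : iota b != 0 by rewrite fmorph_eq0.
pose t := omega i z j + (-1) ^+ e * (2^-1 * s).
have {}hx : x ^+ 2 = t * iota b by rewrite hx /t; ring.
(* The index [j] amounts to replacing [z] by [z ^+ k]; the inverse [k'] of [k] modulo 7 serves to
   recover [z] at the end. *)
have [k [k' [kk [hk hq]]]] : exists k k', (k * k' = 1 %[mod 7])%N /\
    (~~ (7 %| k)%N /\ quad i (z ^+ k) t = 0).
  have zV : z^-1 = z ^+ 6.
    have z0 : z != 0.
      apply: contra_eq_neq (prim_expr_order hz) => ->.
      by rewrite expr0n eq_sym oner_neq0.
    by apply: (mulfI z0); rewrite mulfV // -exprS (prim_expr_order hz).
  (* The sign is absorbed into the choice of the square root of [theta i z j]. *)
  have hsg : ((-1) ^+ e * s) ^+ 2 = theta i z j.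
    by rewrite exprMn sqrr_sign mul1r.
  have {hy hs}Q l : ~~ (7 %| l)%N -> omega i z j = omega1 i (z ^+ l) ->
      theta i z j = theta1 i (z ^+ l) -> quad i (z ^+ l) t = 0.
    move=> hl ho hth; rewrite /t ho mulrCA; apply: quad_root_omega1 => //.
      exact: prim_root7X.
    by rewrite hsg.
  have p5 : 7.-primitive_root (z ^+ 5) by apply: prim_root7X.
  have p3 : 7.-primitive_root (z ^+ 3) by apply: prim_root7X.
  have p6 : 7.-primitive_root (z ^+ 6) by apply: prim_root7X.
  have c5 : (z ^+ 6) ^+ 5 = (z ^+ 5) ^+ 6 by rewrite -!exprM.
  have c3 : (z ^+ 6) ^+ 3 = (z ^+ 3) ^+ 6 by rewrite -!exprM.
  clear hsg; case: j hj @t hx Q => [|[|[|[|[|[|[|//]]]]]]] // _ t hx Q.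
  - by exists 1%N, 1%N; split=> //; split=> //; apply: Q.
  - exists 1%N, 1%N; split=> //; split=> //; apply: Q.
    + by [].
    + by rewrite /omega zV omega1_conj.
    + by rewrite /theta zV theta1_conj.
  - exists 5, 3; split=> //; split=> //; apply: Q.
    + by [].
    + exact: omega3_omega1.
    + exact: theta3_theta1.
  - exists 5, 3; split=> //; split=> //; apply: Q.
    + by [].
    + by rewrite /omega zV omega3_omega1 // c5 omega1_conj.
    + by rewrite /theta zV theta3_theta1 // c5 theta1_conj.
  - exists 3, 5; split=> //; split=> //; apply: Q.
    + by [].
    + exact: omega5_omega1.
    + exact: theta5_theta1.
  - exists 3, 5; split=> //; split=> //; apply: Q.
    + by [].
    + by rewrite /omega zV omega5_omega1 // c3 omega1_conj.
    + by rewrite /theta zV theta5_theta1 // c3 theta1_conj.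
have pk := prim_root7X hz hk.
split; last first.
  by rewrite rmorph0; apply: (root_exact_order natS_neq0 b0 hi pk hx hy hq).
rewrite /division_field rmorph0 => u; split=> hu L hL LK LS.
  have Li : L i by apply: LS; rewrite !inE eqxx.
  have Lz : L z by apply: LS; rewrite !inE eqxx orbT.
  have Ly : L y by apply: LS; rewrite !inE eqxx !orbT.
  apply: hu => // v.
  apply: (torsion7_sub_generated natS_neq0 b0 hi pk hx hy hq) => //.
  exact: subfieldX.
have [Li Lz Ly] :=
  generators_in_torsion7 natS_neq0 b0 hi pk hx hy hq hL (LK b) LS.
apply: hu => // v; rewrite !inE => /or3P[] /eqP -> //.
have -> : z = (z ^+ k) ^+ k'.
  by rewrite -exprM -(prim_expr_mod hz) kk.
exact: subfieldX.
Qed.
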